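(* Let $G$ be a graph with at least one edge. Then $epa(G) \leq Epa(G) \leq 3$. Moreover, (a) $Epa(G) = 3$ if and only if $G$ has a $\gamma$-set that is not independent, and (b) $epa(G) = 3$ if and only if for each pair of adjacent vertices $u$ and $v$ of $G$ at least one of the following is true: there exists a $\gamma$-set of $G$ which contains both $u$ and $v$; at least one of $u$ and $v$ is in $V^-(G)$.
   Context: Graphs are finite and simple. $\gamma(H)$ denotes the domination number of a graph $H$; a $\gamma$-set of $H$ is a dominating set of $H$ of cardinality $\gamma(H)$. $V^-(H) = \{x \in V(H) \mid \gamma(H-x) < \gamma(H)\}$. For distinct vertices $u,v$ of $G$ and an integer $k\geq 0$, $G_{u,v,k}$ denotes the graph obtained from the disjoint union of $G$ and a path $x_0,x_1,\dots,x_{k+1}$ by identifying $u$ with $x_0$ and $v$ with $x_{k+1}$ (so $k$ new vertices are added; the edge $uv$ of $G$, if present, is kept; when $k=0$ and $uv\in E(G)$ this is just $G$, up to a parallel edge). $pa(u,v)$ is the minimum integer $k\geq 0$ such that $\gamma(G) < \gamma(G_{u,v,k})$. $epa(G) = \min\{pa(u,v) \mid uv \in E(G)\}$ and $Epa(G) = \max\{pa(u,v) \mid uv \in E(G)\}$. *)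

(* Defs.v *)
From mathcomp Require Import all_boot.

Set Implicit Arguments.
Unset Strict Implicit.
Unset Printing Implicit Defensive.

(* A graph is a finType V of vertices with an adjacency relation e : rel V,
   assumed symmetric and irreflexive where simplicity is needed. *)

Definition dominating (V : finType) (e : rel V) (D : {set V}) : bool :=
  [forall x, (x \in D) || [exists y in D, e x y]].

Definition domnum (V : finType) (e : rel V) : nat :=
  #|[arg min_(D < [set: V] | dominating e D) #|D| ]|.

Definition gamma_set (V : finType) (e : rel V) (D : {set V}) : bool :=
  dominating e D && (#|D| == domnum e).

Definition independent (V : finType) (e : rel V) (D : {set V}) : bool :=
  [forall x in D, forall y in D, ~~ e x y].

Definition del_vertex (V : finType) (e : rel V) (x : V) :
  rel {y : V | y != x} := fun a b => e (val a) (val b).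
Arguments del_vertex {V} e x.

Definition Vminus (V : finType) (e : rel V) : {set V} :=
  [set x | domnum (del_vertex e x) < domnum e].

(* The vertices x_0 = u, x_1, ..., x_k, x_(k+1) = v of the added path: the new
   vertex x_(i+1) is inr i for i < k (indices beyond k+1 also give v). *)
Definition path_vertex (V : finType) (u v : V) (k i : nat) : V + 'I_k :=
  if i is j.+1 then
    if insub j is Some o then inr o else inl v
  else inl u.
Arguments path_vertex : simpl never.

(* G_{u,v,k}: the edges of G together with the edges x_i x_(i+1), i <= k.
   As adjacency is a relation, the k = 0 case with uv already an edge gives
   back G, without a parallel edge. *)
Definition add_path (V : finType) (e : rel V) (u v : V) (k : nat) :
  rel (V + 'I_k) := fun a b =>
  match a, b with inl x, inl y => e x y | _, _ => false end
  || [exists i : 'I_k.+1,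
        let x := path_vertex u v k i in
        let y := path_vertex u v k i.+1 in
        ((a == x) && (b == y)) || ((a == y) && (b == x))].
Arguments add_path {V} e u v k.

Lemma setT_dominating (V : finType) (e : rel V) : dominating e [set: V].
Proof. by apply/forallP => x; rewrite in_setT. Qed.

Lemma domnum_le (V : finType) (e : rel V) (D : {set V}) :
  dominating e D -> domnum e <= #|D|.
Proof.
rewrite /domnum; case: arg_minnP => [|D0 _ minD0]; first exact: setT_dominating.
exact: minD0.
Qed.

Lemma domnum_attained (V : finType) (e : rel V) :
  exists2 D : {set V}, dominating e D & #|D| = domnum e.
Proof.
rewrite /domnum; case: arg_minnP => [|D0 domD0 _]; first exact: setT_dominating.
by exists D0.
Qed.

(* An internal path vertex whose index is 1 mod 3 can only be dominated from
   its own block of three new vertices, so a long enough path forces more than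
   #|V| dominating vertices. *)
Lemma pa_exists (V : finType) (e : rel V) (u v : V) :
  exists k, domnum e < domnum (add_path e u v k).
Proof.
set n := #|V|; exists (3 * n.+1)%N; set k := (3 * n.+1)%N.
have le_n : domnum e <= n.
  by rewrite -[n]cardsT domnum_le // setT_dominating.
have [D domD <-] := domnum_attained (add_path e u v k).
apply: leq_ltn_trans le_n _; rewrite -[n.+1]card_ord.
pose blk (a : V + 'I_k) : 'I_n.+1 :=
  if a is inr i then inord (i %/ 3) else ord0.
apply: leq_trans (leq_imset_card blk D).
apply/subset_leq_card/subsetP => j _.
have lt_m : 3 * j + 1 < k.
  by rewrite /k -ltn_subRL -mulnBr (@leq_trans 3) // leq_pmulr // subn_gt0.
pose m : 'I_k := Ordinal lt_m.
have blkE (i : 'I_k) (r : nat) : i = 3 * j + r :> nat -> r < 3 -> blk (inr i) = j.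
  move=> Ei ltr; apply/val_inj; rewrite /= Ei mulnC divnMDl // divn_small //.
  by rewrite addn0 inordK.
have pvE i (lti : i < k) : path_vertex u v k i.+1 = inr (Ordinal lti).
  by rewrite /path_vertex (insubT (fun i => i < k) lti).
have := forallP domD (inr m); case/orP => [mD|/existsP[y /andP[yD]]].
  by apply/imsetP; exists (inr m) => //; rewrite (@blkE m 1).
rewrite /add_path /= => /existsP[[i lti] /=]; rewrite ltnS in lti.
case/orP=> /andP[/eqP Em /eqP Ey]; apply/imsetP; exists y => //.
  case: i lti Em Ey => [//|i] lti; rewrite (pvE _ lti) => -[Ei].
  have ei : i.+1 = 3 * j + 2 by rewrite -Ei addn1 addn2.
  have lti2 : i.+1 < k.
    rewrite ei /k -ltn_subRL -mulnBr (@leq_trans 3) // leq_pmulr //.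
    by rewrite subn_gt0.
  by rewrite (pvE _ lti2) => ->; rewrite (@blkE _ 2).
move: Em Ey; case: (ltnP i k) => [ltik|leki].
  rewrite (pvE _ ltik) => -[Ei]; case: i {lti} ltik Ei => [|i] ltik Ei.
    by rewrite addn1 in Ei.
  have ei : i = 3 * j + 0 by move: Ei; rewrite addn1 addn0 => -[].
  by rewrite (pvE _ (ltnW ltik)) => ->; rewrite (@blkE _ 0).
by rewrite /path_vertex insubF // ltnNge leki.
Qed.

Definition pa (V : finType) (e : rel V) (u v : V) : nat :=
  ex_minn (pa_exists e u v).

(* Ordered pairs: each edge uv contributes both pa(u,v) and pa(v,u). *)
Definition pa_values (V : finType) (e : rel V) : seq nat :=
  [seq pa e p.1 p.2 | p <- enum {: V * V} & e p.1 p.2].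

(* The minimum and maximum of pa_values when e has an edge (see epaP, EpaP);
   both are 0 otherwise. *)
Definition epa (V : finType) (e : rel V) : nat :=
  \big[minn/head 0 (pa_values e)]_(k <- pa_values e) k.

Definition Epa (V : finType) (e : rel V) : nat :=
  \max_(k <- pa_values e) k.

Lemma pa_valuesP (V : finType) (e : rel V) (k : nat) :
  reflect (exists u v, e u v /\ pa e u v = k) (k \in pa_values e).
Proof.
apply: (iffP mapP) => [[[u v]]|[u [v [euv <-]]]].
  by rewrite mem_filter /= => /andP[euv _] ->; exists u, v.
by exists (u, v); rewrite // mem_filter /= euv mem_enum.
Qed.

Lemma epaP (V : finType) (e : rel V) : (exists u v, e u v) ->
  (exists u v, e u v /\ pa e u v = epa e) /\
  (forall u v, e u v -> epa e <= pa e u v).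
Proof.
move=> [u0 [v0 euv0]]; split=> [|u v euv].
  apply/pa_valuesP; rewrite /epa; set s := pa_values e.
  have hs : head 0 s \in s.
    have: pa e u0 v0 \in s by apply/pa_valuesP; exists u0, v0.
    by case: s => //= a s _; rewrite mem_head.
  rewrite big_seq; elim/big_ind: _ => // x y xs ys.
  by rewrite /minn; case: ifP.
have: pa e u v \in pa_values e by apply/pa_valuesP; exists u, v.
rewrite /epa; elim: (pa_values e) (head 0 _) => //= a s IH d.
rewrite big_cons in_cons => /orP[/eqP->|/IH le]; first exact: geq_minl.
exact: leq_trans (geq_minr _ _) (le _).
Qed.

Lemma EpaP (V : finType) (e : rel V) : (exists u v, e u v) ->
  (exists u v, e u v /\ pa e u v = Epa e) /\
  (forall u v, e u v -> pa e u v <= Epa e).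
Proof.
move=> [u0 [v0 euv0]].
have le u v : e u v -> pa e u v <= Epa e.
  move=> euv; rewrite /Epa; apply: (@leq_bigmax_seq _ _ predT id) => //.
  by apply/pa_valuesP; exists u, v.
split=> //; apply/pa_valuesP.
have: Epa e \in 0 :: pa_values e.
  rewrite /Epa big_seq; elim/big_ind: _ => [|x y xs ys|x xs].
  - exact: mem_head.
  - by rewrite /maxn; case: ifP.
  - by rewrite in_cons xs orbT.
rewrite in_cons => /orP[/eqP E0|//]; rewrite E0.
have := le _ _ euv0; rewrite E0 leqn0 => /eqP p0.
by apply/pa_valuesP; exists u0, v0.
Qed.

(* Main.v *)
Require Import Defs.
From mathcomp Require Import all_boot.
From mathcomp Require Import zify.

(* For an edge uv, a set of at most gamma(G) vertices cannot dominate
   G_{u,v,3}: as the edge uv lets u stand in for every new vertex that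
   dominates u or v, its trace on G would lead to a dominating set of G of size
   less than gamma(G). Applied to G_{u,v,2}, the same trace argument shows that
   gamma does not increase exactly when u and v lie in a common gamma-set or
   one of them is in V^-; in that case G_{u,v,1} does not increase it either,
   so this condition is equivalent to pa(u,v) = 3. Finally, if u is in V^-,
   adding v to a minimum dominating set of G - u gives a gamma-set of G, which
   contains an edge because v is dominated in G - u. *)

Set Implicit Arguments.
Unset Strict Implicit.
Unset Printing Implicit Defensive.

(** * Domination and critical vertices *)

Definition dominated (V : finType) (e : rel V) (D : {set V}) (x : V) : bool :=
  (x \in D) || [exists y in D, e x y].

Lemma dominatingP (V : finType) (e : rel V) (D : {set V}) :
  reflect (forall x, dominated e D x) (dominating e D).
Proof. exact: forallP. Qed.

Lemma dominated_sub (V : finType) (e : rel V) (A B : {set V}) (x : V) :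
  A \subset B -> dominated e A x -> dominated e B x.
Proof.
move=> sAB /orP[xA|/exists_inP[y yA exy]].
  by rewrite /dominated (subsetP sAB).
by apply/orP; right; apply/exists_inP; exists y; rewrite ?(subsetP sAB).
Qed.

Lemma dominated_adj (V : finType) (e : rel V) (A : {set V}) (x y : V) :
  e x y -> y \in A -> dominated e A x.
Proof. by move=> exy yA; apply/orP; right; apply/exists_inP; exists y. Qed.

Lemma dominating_ltF (V : finType) (e : rel V) (D : {set V}) :
  dominating e D -> #|D| < domnum e -> False.
Proof. by move/domnum_le=> le; rewrite ltnNge le. Qed.

Lemma domnum_leP (V : finType) (e : rel V) (m : nat) :
  domnum e <= m <-> exists2 D, dominating e D & #|D| <= m.
Proof.
split=> [le_m|[D domD]]; last exact: leq_trans (domnum_le domD).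
by have [D domD cardD] := domnum_attained e; exists D; rewrite ?cardD.
Qed.

Lemma gamma_setE (V : finType) (e : rel V) (D : {set V}) :
  gamma_set e D = dominating e D && (#|D| <= domnum e).
Proof.
by apply: andb_id2l => /domnum_le ge; rewrite eqn_leq ge andbT.
Qed.

(** Replaces the subtype of $G-u$ by sets in $G$: such an [A] cannot contain [u], since it would
    then dominate all of $G$ with fewer than [domnum e] vertices. *)
Lemma VminusP (V : finType) (e : rel V) (u : V) :
  u \in Vminus e <->
  exists2 A : {set V},
    #|A| < domnum e & forall x, x != u -> dominated e A x.
Proof.
rewrite inE; split=> [|[A ltA domA]].
  have [D /dominatingP domD <-] := domnum_attained (del_vertex e u) => ltD.
  exists (val @: D); first by rewrite card_imset //; apply: val_inj.
  move=> x xu; have /orP[xD|/exists_inP[y yD exy]] := domD (Sub x xu).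
    by apply/orP; left; apply/imsetP; exists (Sub x xu).
  by apply: (@dominated_adj _ _ _ _ (val y)) => //; apply: imset_f.
have uA : u \notin A.
  apply/negP=> uA; apply: (dominating_ltF _ ltA); apply/dominatingP=> x.
  by have [->|/domA//] := eqVneq x u; rewrite /dominated uA.
apply: leq_ltn_trans ltA; apply/domnum_leP.
have inA (y : V) : y \in A -> y != u by apply: contraTneq => ->.
exists (val @^-1: A).
  apply/dominatingP=> x; have /orP[xA|/exists_inP[y yA exy]] := domA _ (valP x).
    by rewrite /dominated inE xA.
  by apply: (@dominated_adj _ _ _ _ (Sub y (inA y yA))); rewrite ?inE.
rewrite -(card_imset _ val_inj); apply/subset_leq_card/subsetP => y.
by case/imsetP=> z; rewrite inE => zA ->.
Qed.

(** * Dominating sets of the graph with an added path *)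

Lemma path_vertex_inr (V : finType) (u v : V) k (j : 'I_k) :
  path_vertex u v k j.+1 = inr j.
Proof. by rewrite /path_vertex valK. Qed.

Lemma path_vertex_last (V : finType) (u v : V) k :
  path_vertex u v k k.+1 = inl v.
Proof. by rewrite /path_vertex insubF ?ltnn. Qed.

Lemma path_vertex_eq_inr (V : finType) (u v : V) k i (j : 'I_k) :
  (inr j == path_vertex u v k i) = (i == j.+1).
Proof.
case: i => [|i]; rewrite /path_vertex //= eqSS.
case: insubP => [o _ <-|le_ki]; first by rewrite [RHS]eq_sym.
by apply/esym/negbTE; apply: contraNneq le_ki => ->.
Qed.

(** The bound on [i] excludes the indices beyond [k.+1], where [path_vertex] is also [inl v]. *)
Lemma path_vertex_eq_inl (V : finType) (u v : V) k i x : i <= k.+1 ->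
  (inl x == path_vertex u v k i) =
  (i == 0) && (x == u) || (i == k.+1) && (x == v).
Proof.
case: i => [|i] le_ik; first by rewrite orbF.
rewrite /path_vertex /= eqSS; case: insubP => [o lt_ik _|le_ki].
  by rewrite ltn_eqF.
by have -> : i == k by lia.
Qed.

Lemma dominated_add_path (V : finType) (e : rel V) (u v : V) k
    (D : {set V + 'I_k}) (a : V + 'I_k) :
  dominated (add_path e u v k) D a =
  [|| a \in D,
      if a is inl x then [exists y in inl @^-1: D, e x y] else false
    | [exists i : 'I_k.+1,
        (a == path_vertex u v k i) && (path_vertex u v k i.+1 \in D) ||
        (a == path_vertex u v k i.+1) && (path_vertex u v k i \in D)]].
Proof.
congr (_ || _); apply/exists_inP/orP => [[b bD /orP[]]|[]].
- case: a b bD => [x|//] [y|//] yD exy; left; apply/exists_inP; exists y => //.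
  by rewrite inE.
- case/existsP=> i /= /orP[] /andP[/eqP-> /eqP Eb]; right.
    by apply/existsP; exists i; rewrite -Eb bD eqxx.
  by apply/existsP; exists i; rewrite -Eb bD eqxx orbT.
- case: a => // x /exists_inP[y]; rewrite inE => yD exy.
  by exists (inl y) => //; rewrite /add_path exy.
case/existsP=> i /orP[] /andP[/eqP Ea bD].
  exists (path_vertex u v k i.+1) => //; apply/orP; right; apply/existsP.
  by exists i; rewrite /= Ea !eqxx.
exists (path_vertex u v k i) => //; apply/orP; right; apply/existsP.
by exists i; rewrite /= Ea !eqxx orbT.
Qed.

(** On the path, [u] has the neighbour $x_1$ and [v] the neighbour $x_k$. For [k = 0] these are [v]
    and [u], so the added edge is covered too. *)
Lemma dominated_add_path_inl (V : finType) (e : rel V) (u v : V) k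
    (D : {set V + 'I_k}) (x : V) :
  dominated (add_path e u v k) D (inl x) =
  [|| dominated e (inl @^-1: D) x,
      (x == u) && (path_vertex u v k 1 \in D)
    | (x == v) && (path_vertex u v k k \in D)].
Proof.
rewrite dominated_add_path /dominated inE -!orbA; do 2!congr (_ || _).
apply/existsP/orP => [[i]|[] /andP[/eqP-> pD]].
- have lti := ltn_ord i.
  rewrite !path_vertex_eq_inl ?(ltnW lti) // (ltn_eqF lti) orbF.
  case/orP=> /andP[].
    by case/andP=> /eqP-> -> ->; left.
  by case/andP=> /eqP[->] -> ->; right.
- by exists ord0; rewrite eqxx pD.
by exists ord_max; rewrite path_vertex_last eqxx pD orbT.
Qed.

Lemma dominated_add_path_inr (V : finType) (e : rel V) (u v : V) k
    (D : {set V + 'I_k}) (j : 'I_k) :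
  dominated (add_path e u v k) D (inr j) =
  [|| path_vertex u v k j \in D, path_vertex u v k j.+1 \in D
    | path_vertex u v k j.+2 \in D].
Proof.
rewrite dominated_add_path orFb orbCA path_vertex_inr; congr (_ || _).
apply/existsP/orP => [[i]|[] pD].
- rewrite !path_vertex_eq_inr.
  case/orP=> /andP[/eqP Ei]; first by rewrite Ei; right.
  by move/eqP: Ei; rewrite eqSS => /eqP->; left.
- have lt_j : j < k.+1 by rewrite ltnS ltnW.
  by exists (Ordinal lt_j); rewrite !path_vertex_eq_inr pD eqxx orbT.
have lt_j : j.+1 < k.+1 by rewrite ltnS.
by exists (Ordinal lt_j); rewrite !path_vertex_eq_inr pD eqxx.
Qed.

Lemma card_sum_set (V W : finType) (D : {set V + W}) :
  #|D| = #|inl @^-1: D| + \sum_(w : W) (inr w \in D).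
Proof.
rewrite -!sum1_card big_mkcond big_sumType /= [in RHS]big_mkcond /=.
by congr (_ + _); apply: eq_bigr => w _; rewrite ?inE; case: ifP.
Qed.

(* A set of vertices of G_{u,v,k} is encoded by its trace A on V and the
   indicator p of its intersection with the path x_0, ..., x_(k+1). *)
Lemma domnum_add_path_leP (V : finType) (e : rel V) (u v : V) k m :
  domnum (add_path e u v k) <= m <->
  exists (A : {set V}) (p : nat -> bool),
    [/\ p 0 = (u \in A), p k.+1 = (v \in A),
        #|A| + \sum_(j < k) p j.+1 <= m,
        forall x, [|| dominated e A x, (x == u) && p 1 | (x == v) && p k]
      & forall j, j < k -> [|| p j, p j.+1 | p j.+2]].
Proof.
rewrite domnum_leP; split=> [[D /dominatingP domD cardD]|].
  exists (inl @^-1: D), (fun i => path_vertex u v k i \in D); split.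
  - by rewrite inE.
  - by rewrite path_vertex_last inE.
  - apply: leq_trans cardD; rewrite card_sum_set leq_add2l.
    by apply/eq_leq/eq_bigr=> j _; rewrite path_vertex_inr.
  - by move=> x; rewrite -dominated_add_path_inl.
  by move=> j ltj; rewrite -(dominated_add_path_inr e u v D (Ordinal ltj)).
move=> [A [p [p0 pk cardA domA domp]]].
pose D : {set V + 'I_k} := [set a : V + 'I_k |
  match a with inl x => x \in A | inr j => p j.+1 end].
have DA : inl @^-1: D = A by apply/setP=> x; rewrite !inE.
have Dp i : i <= k.+1 -> (path_vertex u v k i \in D) = p i.
  case: i => [|i]; first by rewrite inE p0.
  rewrite ltnS leq_eqVlt => /predU1P[->|lti].
    by rewrite path_vertex_last inE pk.
  by rewrite -[i]/(val (Ordinal lti)) path_vertex_inr inE.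
exists D.
  apply/dominatingP=> -[x|j].
    by rewrite dominated_add_path_inl DA !Dp.
  have ltj := ltn_ord j.
  by rewrite dominated_add_path_inr !Dp ?domp //; lia.
rewrite card_sum_set DA; apply: leq_trans cardA; rewrite leq_add2l.
by apply/eq_leq/eq_bigr=> j _; rewrite inE.
Qed.

Lemma domnum_add_path0 (V : finType) (e : rel V) (u v : V) :
  domnum (add_path e u v 0) <= domnum e.
Proof.
have [A /dominatingP domA cardA] := domnum_attained e.
apply/domnum_add_path_leP; exists A.
exists (fun i => if i is 0 then u \in A else v \in A).
by split=> // [|x]; rewrite ?big_ord0 ?addn0 ?cardA // domA.
Qed.

(** * Paths attached to the ends of an edge *)

Definition joint_or_critical (V : finType) (e : rel V) (u v : V) : Prop :=
  (exists D : {set V}, [/\ gamma_set e D, u \in D & v \in D]) \/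
  (u \in Vminus e \/ v \in Vminus e).

Section Edge.

Variables (V : finType) (e : rel V) (u v : V).
Hypotheses (e_sym : symmetric e) (euv : e u v).

Lemma dominating_setU1_edge (A : {set V}) :
  (forall x, x != u -> x != v -> dominated e A x) -> dominating e (u |: A).
Proof.
move=> domA; apply/dominatingP=> x.
have [->|xu] := eqVneq x u; first by rewrite /dominated setU11.
have [->|xv] := eqVneq x v.
  by apply: (@dominated_adj _ _ _ _ u); rewrite ?setU11 // e_sym.
by apply: dominated_sub (domA x xu xv); apply: subsetUr.
Qed.

(** A gamma-set containing [u] and [v] already dominates $x_1$. If one end is critical, $x_1$ joins
    a smaller set that misses at most that end, and dominates it. *)
Lemma domnum_add_path1 :
  joint_or_critical e u v -> domnum (add_path e u v 1) <= domnum e.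
Proof.
move=> C; apply/domnum_add_path_leP.
have [[D]|[/VminusP|/VminusP]] := C.
- rewrite gamma_setE => -[/andP[/dominatingP domD cardD] uD vD].
  exists D, (fun i => i != 1); rewrite uD vD big_ord1 addn0.
  by split=> // [x|[]//]; rewrite domD.
- move=> [A ltA domA]; exists A.
  exists (fun i => if i is 0 then u \in A else (i == 1) || (v \in A)).
  rewrite big_ord1 addn1; split=> // [x|[]//]; last by rewrite orbT.
  by have [->|/domA->] := eqVneq x u; rewrite ?orbT.
move=> [A ltA domA]; exists A.
exists (fun i => if i is 0 then u \in A else (i == 1) || (v \in A)).
rewrite big_ord1 addn1; split=> // [x|[]//]; last by rewrite orbT.
by have [->|/domA->] := eqVneq x v; rewrite ?orbT.
Qed.

Lemma domnum_add_path2 :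
  domnum (add_path e u v 2) <= domnum e <-> joint_or_critical e u v.
Proof.
split=> [/domnum_add_path_leP|C].
  move=> [A [p [p0 p3 cardA domA domp]]].
  have := domp 0 isT; have := domp 1 isT.
  move: cardA domA; rewrite p0 p3 !big_ord_recl big_ord0 /=.
  case p1: (p 1); case p2: (p 2); rewrite /= ?addn0 ?add0n.
  (* Both $x_1$ and $x_2$ are chosen: [u] can replace the two, which beats the domination number. *)
  - move=> cardA domA _ _; case: (@dominating_ltF _ e (u |: A)).
      apply: dominating_setU1_edge => x /negPf xu /negPf xv.
      by have := domA x; rewrite xu xv !orbF.
    by rewrite cardsU1; case: (u \notin A); lia.
  (* Only $x_1$ is chosen, and in $G$ it can serve only [u]. *)
  - rewrite addn1 => ltA domA _ _; right; left; apply/VminusP; exists A => // x.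
    by move=> /negPf xu; have := domA x; rewrite xu andbF !orbF.
  - rewrite addn1 => ltA domA _ _; right; right; apply/VminusP; exists A => //.
    by move=> x /negPf xv; have := domA x; rewrite xv andbF !orbF.
  (* Neither is chosen, so dominating $x_1$ and $x_2$ forces [u] and [v] into [A]. *)
  rewrite orbF => cardA domA vA uA; left; exists A; split=> //.
  rewrite gamma_setE cardA andbT; apply/dominatingP=> x.
  by have := domA x; rewrite !andbF !orbF.
apply/domnum_add_path_leP; have [[D]|[/VminusP|/VminusP]] := C.
- rewrite gamma_setE => -[/andP[/dominatingP domD cardD] uD vD].
  exists D, (fun i => (i == 0) || (i == 3)).
  rewrite uD vD !big_ord_recl big_ord0 /= !addn0.
  by split=> // [x|[|[]]//]; rewrite domD.
(* The path neighbour of the critical end dominates that end and both new vertices. *)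
- move=> [A ltA domA]; exists A.
  exists (fun i =>
    if i is 0 then u \in A else if i is 3 then v \in A else i == 1).
  rewrite !big_ord_recl big_ord0 /= addn1; split=> // [x|[|[]]//].
    by have [->|/domA->] := eqVneq x u; rewrite ?orbT.
  by rewrite orbT.
move=> [A ltA domA]; exists A.
exists (fun i =>
  if i is 0 then u \in A else if i is 3 then v \in A else i == 2).
rewrite !big_ord_recl big_ord0 /= addn1; split=> // [x|[|[]]//].
  by have [->|/domA->] := eqVneq x v; rewrite ?orbT.
by rewrite orbT.
Qed.

Lemma domnum_add_path3 : domnum e < domnum (add_path e u v 3).
Proof.
rewrite ltnNge; apply/negP=> /domnum_add_path_leP.
move=> [A [p [p0 p4 cardA domA domp]]].
have euv' : e v u by rewrite e_sym.
(* Rules out two or more new vertices, as [u] could replace them. *)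
have domu : dominating e (u |: A) -> #|A|.+1 < domnum e -> False.
  move=> /dominating_ltF ltF ltA; apply: ltF; rewrite cardsU1.
  by case: (u \notin A); lia.
have /domu {}domu : dominating e (u |: A).
  apply: dominating_setU1_edge => x /negPf xu /negPf xv.
  by have := domA x; rewrite xu xv !orbF.
have noA : (p 1 -> v \in A) -> (p 3 -> u \in A) -> #|A| < domnum e -> False.
  move=> h1 h3; apply: dominating_ltF; apply/dominatingP=> x.
  case/or3P: (domA x) => // /andP[/eqP->].
    by move/h1; apply: dominated_adj.
  by move/h3; apply: dominated_adj.
(* Dominating $x_2$ takes a new vertex, so by [domu] exactly one. If it is $x_1$, then $x_3$ forces
   [v] into [A]; if it is $x_3$, then $x_1$ forces [u]; if it is $x_2$, the premises of [noA] are
   vacuous. *)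
have := domp 0 isT; have := domp 1 isT; have := domp 2 isT.
move: cardA noA; rewrite -p0 -p4 !big_ord_recl big_ord0 /=.
by case: (p 0); case: (p 1); case: (p 2); case: (p 3); case: (p 4) => /=; lia.
Qed.

Lemma pa_le3 : pa e u v <= 3.
Proof.
by rewrite /pa; case: ex_minnP => n _; apply; apply: domnum_add_path3.
Qed.

Lemma pa_eq3 : pa e u v = 3 <-> joint_or_critical e u v.
Proof.
rewrite -domnum_add_path2; have := pa_le3.
rewrite /pa; case: ex_minnP => n lt_n min_n le_n3; split=> [En|le2].
  by rewrite leqNgt; apply/negP=> /min_n; rewrite En.
(* It remains to exclude the lengths 0 and 1; the bound for 1 follows from the one for 2 through the
   condition on [u] and [v]. *)
have le1 := domnum_add_path1 (domnum_add_path2.1 le2).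
have le0 := domnum_add_path0 e u v.
by case: n lt_n le_n3 {min_n} => [|[|[|[|]]]] //; rewrite ltnNge ?le0 ?le1 ?le2.
Qed.

End Edge.

(** * Gamma-sets containing an edge, and the extremal values *)

Lemma Vminus_gamma_set (V : finType) (e : rel V) (u v : V) :
  symmetric e -> irreflexive e -> e u v -> u \in Vminus e ->
  exists D, gamma_set e D /\ ~~ independent e D.
Proof.
move=> e_sym e_irr euv /VminusP[A ltA domA].
have vu : v != u by apply: contraTneq euv => ->; rewrite e_irr.
(* Were [v] in [A], it would dominate [u] and [A] would dominate $G$; so [v] has a neighbour in
   [A]. *)
have /exists_inP[w wA evw] : [exists w in A, e v w].
  case/orP: (domA v vu) => // vA.
  case: (dominating_ltF _ ltA).
  apply/dominatingP=> x; have [->|/domA//] := eqVneq x u.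
  exact: dominated_adj euv vA.
exists (v |: A); split; last first.
  apply/negP=> /forall_inP/(_ v (setU11 _ _))/forall_inP/(_ w).
  by rewrite evw in_setU1 wA orbT => /(_ isT).
have evu : e v u by rewrite e_sym.
rewrite gamma_setE (dominating_setU1_edge e_sym evu) => [|x _ /domA//].
by rewrite cardsU1; case: (v \notin A); lia.
Qed.

Theorem corollary8 (V : finType) (e : rel V)
  (e_sym : symmetric e) (e_irr : irreflexive e)
  (e_edge : exists u v : V, e u v) :
  (epa e <= Epa e /\ Epa e <= 3) /\
  (Epa e = 3 <->
     exists D : {set V}, gamma_set e D /\ ~~ independent e D) /\
  (epa e = 3 <->
     forall u v : V, e u v ->
       (exists D : {set V}, [/\ gamma_set e D, u \in D & v \in D]) \/
       (u \in Vminus e \/ v \in Vminus e)).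
Proof.
have [[u1 [v1 [e1 E1]]] min_epa] := epaP e_edge.
have [[u2 [v2 [e2 E2]]] max_Epa] := EpaP e_edge.
have Epa3 : Epa e <= 3 by rewrite -E2 pa_le3.
split; first by rewrite -E1 max_Epa.
split; split.
- rewrite -E2 => /(pa_eq3 e_sym e2)[[D [gD uD vD]]|[]].
  + exists D; split=> //; apply/negP=> /forall_inP/(_ _ uD)/forall_inP/(_ _ vD).
    by rewrite e2.
  + exact: Vminus_gamma_set e2.
  + by apply: (@Vminus_gamma_set _ _ v2 u2); rewrite // e_sym.
- move=> [D [gD /forall_inPn[u uD /forall_inPn[v vD]]]]; rewrite negbK => euv.
  apply/eqP; rewrite eqn_leq Epa3 /=.
  have <- : pa e u v = 3 by apply/pa_eq3 => //; left; exists D.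
  exact: max_Epa.
(* Every edge value lies between [epa e] and 3, so a minimum of 3 makes all of them 3. *)
- move=> E3 u v euv; apply/(pa_eq3 e_sym euv)/eqP.
  by rewrite eqn_leq pa_le3 //= -E3 min_epa.
by move=> C; rewrite -E1; apply/(pa_eq3 e_sym e1)/C.
Qed.
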